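(* (i) For all integers $n\ge 1$ and $k\ge 0$, $$C_{n,k}=\sum_{m=0}^{\min(n,k)}(m!)^2\,S(n+1,m+1)\,S(k,m).$$ (ii) For all integers $n\ge 1$ and $k\ge 1$, $$D_{n,k}=\sum_{m=0}^{\min(n,k)}(m!)^2\,S(n,m)\,S(k,m).$$
   Context: $S(a,b)$ denotes the Stirling number of the second kind (number of partitions of an $a$-element set into $b$ nonempty classes; $S(0,0)=1$). A $01$ matrix is lonesum if it is uniquely determined among $01$ matrices of its size by its row sum vector and column sum vector; equivalently (Ryser), no $2\times 2$ submatrix (obtained by deleting rows and columns) equals $\begin{pmatrix}1&0\\0&1\end{pmatrix}$ or $\begin{pmatrix}0&1\\1&0\end{pmatrix}$. Empty matrices (with $0$ rows or $0$ columns) count as lonesum. $C_{n,k}$ is the number of lonesum $01$ matrices of size $n\times k$ in which every column contains at least one $1$. $D_{n,k}$ is the number of lonesum $01$ matrices of size $n\times k$ in which every column and every row contains at least one $1$. *)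

(* Defs.v *)
From mathcomp Require Import all_boot matrix.
Set Implicit Arguments.
Unset Strict Implicit.
Unset Printing Implicit Defensive.

Definition stirling2 (a b : nat) : nat :=
  #|[set P : {set {set 'I_a}} | partition P [set: 'I_a] & #|P| == b]|.

(* 01 matrices are Boolean matrices; the coercion from bool to nat sends true
   to 1 and false to 0. *)
Definition row_sums (n k : nat) (A : 'M[bool]_(n, k)) : 'cV[nat]_n :=
  (\col_i (\sum_(j < k) nat_of_bool (A i j))%N)%R.

Definition col_sums (n k : nat) (A : 'M[bool]_(n, k)) : 'rV[nat]_k :=
  (\row_j (\sum_(i < n) nat_of_bool (A i j))%N)%R.

(* Empty matrices (n = 0 or k = 0) are lonesum, being the only ones of their
   size. *)
Definition lonesum (n k : nat) (A : 'M[bool]_(n, k)) : bool :=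
  [forall B : 'M[bool]_(n, k),
     (row_sums B == row_sums A) && (col_sums B == col_sums A) ==> (B == A)].

Definition every_col_has_1 (n k : nat) (A : 'M[bool]_(n, k)) : bool :=
  [forall j : 'I_k, exists i : 'I_n, A i j].

Definition every_row_has_1 (n k : nat) (A : 'M[bool]_(n, k)) : bool :=
  [forall i : 'I_n, exists j : 'I_k, A i j].

Definition num_lonesum_C (n k : nat) : nat :=
  #|[set A : 'M[bool]_(n, k) | lonesum A & every_col_has_1 A]|.

Definition num_lonesum_D (n k : nat) : nat :=
  #|[set A : 'M[bool]_(n, k) |
      [&& lonesum A, every_col_has_1 A & every_row_has_1 A]]|.

(* Main.v *)
Require Import Defs.
From mathcomp Require Import all_boot matrix perm.

Set Implicit Arguments.
Unset Strict Implicit.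
Unset Printing Implicit Defensive.

(** In a lonesum matrix any two columns, seen as sets of rows, are comparable
    for inclusion: otherwise the two rows witnessing the failure carry a
    permutation submatrix, and exchanging its two columns preserves all the
    margins.  So the distinct columns form a chain; let [m] be its length.
    When no column is zero, sending a column to the number of distinct columns
    strictly containing it is a surjection [g] from the columns onto
    [{0, .., m - 1}], and sending a row [i] to the number [f i] of distinct
    columns containing it is a map to [{0, .., m}] hitting every positive
    value.  The matrix is recovered as [A i j = (g j < f i)], a ladder.
    Conversely such a pair [(f, g)] always yields a lonesum matrix without zero
    column ([threshold_lonesum]), and [m], [f], [g] can be read off from it.
    Hence ([card_ladders]) the matrices with [m] distinct columns are counted
    by a product, (number of [f]) * (number of [g]).

    It remains to count maps with prescribed image.  A surjection onto a set of
    size [m] is a partition into [m] blocks with a labelling of the blocks, so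
    there are [m`! * stirling2 k m] choices for [g] ([card_onto]).  For [f],
    adjoin a dummy row at height 0: the maps [f] become the surjections from
    [n + 1] points onto [m + 1] values with the value of one point prescribed,
    a proportion [1 / (m + 1)] of all of them, that is
    [m`! * stirling2 n.+1 m.+1] ([card_row_heights]).  Requiring that no row
    is zero means that [f] never takes the value 0, hence maps onto the [m]
    positive values, which leaves [m`! * stirling2 n m]. *)

(** * Maps with a prescribed image *)

Definition onto (aT rT : finType) (B : {set rT}) : {set {ffun aT -> rT}} :=
  [set f : {ffun aT -> rT} | f @: [set: aT] == B].

(** The maps with kernel [P] correspond to the injections of the set of blocks
    of [P] into [B]; such an injection is onto [B] because the two sets have the
    same size. *)
Lemma card_onto_kernel (aT rT : finType) (B : {set rT}) (P : {set {set aT}}) :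
  partition P [set: aT] -> #|P| = #|B| ->
  #|[set f in onto aT B | preim_partition f [set: aT] == P]| = #|B|`!.
Proof.
move=> partP cardP.
have covP x : x \in cover P by rewrite (cover_partition partP) inE.
have trivP : trivIset P by case/and3P: partP.
pose block x : {C | C \in P} := Sub (pblock P x) (pblock_mem (covP x)).
have block_onto C : {x | block x = C}.
  have /set0Pn /sigW [x xC] : val C != set0.
    by case/and3P: partP => _ _; apply: contraNneq => <-; apply: valP.
  by exists x; apply: val_inj; rewrite /= (def_pblock trivP (valP C) xC).
have cardD : #|{: {C | C \in P}}| = #|B| by rewrite card_sig -cardP.
pose Phi (h : {ffun {C | C \in P} -> rT}) := [ffun x => h (block x)].
have Phi_inj : injective Phi.
  move=> h h' /ffunP eq_h; apply/ffunP => C.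
  by have [x <-] := block_onto C; have := eq_h x; rewrite !ffunE.
rewrite -(ffactnn #|B|) -[in X in X ^_ _]cardD -[in RHS]cardD.
rewrite [in X in X ^_ _]cardD -(card_inj_ffuns_on _ (mem B)).
rewrite -(card_imset _ Phi_inj); apply: eq_card => f.
rewrite !inE; apply/andP/imsetP => [[/eqP fB /eqP fP] | [h]].
  have f_block x y : (f x == f y) = (block x == block y).
    rewrite -val_eqE /= (eq_pblock _ trivP) // -{1}fP /preim_partition.
    rewrite pblock_equivalence_partition ?inE // => a b c _ _ _.
    by split=> // /eqP->.
  exists [ffun C => f (sval (block_onto C))].
    rewrite inE; apply/andP; split.
      by apply/ffun_onP => C; rewrite ffunE -fB imset_f.
    apply/injectiveP => C C'; rewrite !ffunE => /eqP.
    by rewrite f_block !(svalP (block_onto _)) => /eqP.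
  apply/ffunP => x; rewrite !ffunE; apply/eqP; rewrite f_block.
  by rewrite (svalP (block_onto _)).
rewrite inE => /andP[/ffun_onP hB /injectiveP h_inj] ->; split.
  have -> : Phi h @: setT = h @: setT.
    apply/setP=> y; apply/imsetP/imsetP=> [[x _ ->]|[C _ ->]].
      by exists (block x); rewrite ?ffunE.
    by have [x <-] := block_onto C; exists x; rewrite ?ffunE.
  rewrite eqEcard card_imset // cardsT cardD leqnn andbT.
  by apply/subsetP => _ /imsetP[C _ ->]; apply: hB.
apply/eqP; rewrite -[RHS](preim_partition_pblock partP).
rewrite /preim_partition /equivalence_partition; apply: eq_imset => x.
by apply/setP => y; rewrite !inE !ffunE (inj_eq h_inj) -val_eqE.
Qed.

(** Sorting the maps by their kernel, a partition with as many blocks as there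
    are values. *)
Lemma card_onto n (rT : finType) (B : {set rT}) :
  #|onto 'I_n B| = #|B|`! * stirling2 n #|B|.
Proof.
pose ker (f : {ffun 'I_n -> rT}) := preim_partition f [set: 'I_n].
pose Q := [set P | partition P [set: 'I_n] & #|P| == #|B|].
rewrite mulnC /stirling2 -/Q -sum1_card.
rewrite (partition_big ker (fun P => P \in Q)) => [|f]; last first.
  rewrite /= !inE preim_partitionP /= => /eqP <-.
  pose fib (y : rT) := [set x | f x == y].
  have -> : ker f = fib @: (f @: [set: 'I_n]).
    rewrite /ker /preim_partition /equivalence_partition -imset_comp.
    by apply: eq_imset => x; apply/setP => y; rewrite !inE eq_sym.
  rewrite card_in_imset // => y y' /imsetP[x _ ->] _ /setP /(_ x).
  by rewrite !inE eqxx => /esym/eqP.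
rewrite -sum_nat_const; apply: eq_bigr => P; rewrite inE => /andP[partP /eqP cP].
rewrite -(card_onto_kernel partP cP) -sum1_card; apply: eq_bigl => f.
by rewrite [in RHS]inE.
Qed.

(** Once the value at the first point is fixed to [y], the remaining values are
    only required to cover what differs from [y]. *)
Lemma card_onto_cons n (rT : finType) (y : rT) :
  #|[set f in onto 'I_n.+1 [set: rT] | f ord0 == y]|
    = #|[set f : {ffun 'I_n -> rT} | [set~ y] \subset f @: setT]|.
Proof.
pose cons (h : {ffun 'I_n -> rT}) : {ffun 'I_n.+1 -> rT} :=
  [ffun i => if unlift ord0 i is Some j then h j else y].
have cons0 h : cons h ord0 = y by rewrite ffunE unlift_none.
have consS h j : cons h (lift ord0 j) = h j by rewrite ffunE liftK.
have cons_inj : injective cons.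
  by move=> h h' /ffunP eq_h; apply/ffunP => j; rewrite -!consS eq_h.
have cons_im h : cons h @: setT = y |: h @: setT.
  apply/setP => z; rewrite !inE; apply/imsetP/predU1P.
    case=> i _ ->; case: (unliftP ord0 i) => [j|] ->; last by rewrite cons0; left.
    by right; rewrite consS imset_f.
  case=> [->|/imsetP[j _ ->]]; first by exists ord0; rewrite ?cons0.
  by exists (lift ord0 j); rewrite ?consS.
have onto_cons h : (cons h @: setT == setT) = ([set~ y] \subset h @: setT).
  rewrite cons_im -subTset; apply/subsetP/subsetP => sub z.
    by rewrite !inE => zy; have := sub z; rewrite !inE (negPf zy); apply.
  by rewrite !inE => _; case: eqVneq => //= zy; apply: sub; rewrite !inE.
rewrite -(card_imset _ cons_inj); apply: eq_card => f; rewrite !inE.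
apply/andP/imsetP => [[fT /eqP f0] | [h]].
  suff fE : f = cons [ffun j => f (lift ord0 j)].
    by exists [ffun j => f (lift ord0 j)]; rewrite // inE -onto_cons -fE.
  apply/ffunP => i; case: (unliftP ord0 i) => [j|] ->; last by rewrite cons0.
  by rewrite consS ffunE.
by rewrite inE => hy ->; rewrite onto_cons cons0.
Qed.

Lemma card_covering_all_but n (rT : finType) (y : rT) :
  #|[set f : {ffun 'I_n -> rT} | [set~ y] \subset f @: setT]|
    = #|onto 'I_n [set: rT]| + #|onto 'I_n [set~ y]|.
Proof.
rewrite -cardsUI [X in _ = _ + X](_ : _ = 0).
  rewrite addn0; apply: eq_card => f; rewrite !inE; apply/idP/orP => [sub|].
    case yf: (y \in f @: setT); [left | right];
      rewrite eqEsubset ?subsetT ?sub ?andbT.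
      apply/subsetP => z _; case: (eqVneq z y) => [->//|zy].
      by apply: (subsetP sub); rewrite !inE.
    by apply/subsetP => z zf; rewrite !inE; apply: contraFneq yf => <-.
  by case=> /eqP->; rewrite ?subsetT.
apply/eqP; rewrite cards_eq0; apply/eqP/setP => f; rewrite !inE.
by apply/andP => -[/eqP-> /eqP/setP/(_ y)]; rewrite !inE eqxx.
Qed.

(** The heights of the rows of a ladder with [m] levels (see [ladder]).  The
    value 0 is exempted because a ladder may or may not have a zero row, whereas
    a positive height never attained would make two levels coincide or the last
    column zero. *)
Definition row_heights n m : {set {ffun 'I_n -> 'I_m.+1}} :=
  [set f : {ffun 'I_n -> 'I_m.+1} | [set~ ord0] \subset f @: setT].

(** The count of maps covering all values but [y] does not depend on [y], as it
    is a sum of numbers of maps with images of size [m.+1] and [m]; the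
    surjections of [n.+1] points onto [m.+1] values therefore split, along the
    value of the first point, into [m.+1] classes of this same size. *)
Lemma card_row_heights n m :
  #|row_heights n m| = m`! * stirling2 n.+1 m.+1.
Proof.
have cardC (y : 'I_m.+1) : #|[set~ y]| = m by rewrite cardsC1 card_ord.
have fiber (y : 'I_m.+1) :
    #|[set f in onto 'I_n.+1 [set: 'I_m.+1] | f ord0 == y]|
      = #|row_heights n m|.
  by rewrite card_onto_cons !card_covering_all_but !card_onto !cardC.
apply/eqP; rewrite -(eqn_pmul2l (ltn0Sn m)) mulnA -factS.
have := card_onto n.+1 [set: 'I_m.+1]; rewrite cardsT card_ord => <-.
rewrite -[X in _ == X]sum1_card.
rewrite (partition_big (fun f : {ffun 'I_n.+1 -> 'I_m.+1} => f ord0) predT) //=.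
rewrite -[X in X * _]card_ord -sum_nat_const; apply/eqP/eq_bigr => y _.
by rewrite -(fiber y) -sum1_card; apply: eq_bigl => f; rewrite [in LHS]inE.
Qed.

(** * Lonesum matrices and chains of columns *)

(** Pay [2 f i] for an entry 1 and [2 g j + 1] for an entry 0.  The total price
    of a matrix depends only on its row and column sums, and [A] chooses the
    dearer of the two prices at each entry.  These never tie, by parity, so a
    matrix with the margins of [A], having the same price, agrees with [A]
    everywhere. *)
Lemma threshold_lonesum n k (f : 'I_n -> nat) (g : 'I_k -> nat)
    (A : 'M[bool]_(n, k)) :
  (forall i j, A i j = (g j < f i)) -> lonesum A.
Proof.
move=> A_fg; apply/forallP => B; apply/implyP => /andP[/eqP eq_row /eqP eq_col].
pose w (b : bool) i j := b * (f i).*2 + ~~ b * (g j).*2.+1.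
pose W (M : 'M[bool]_(n, k)) := \sum_i \sum_j w (M i j) i j.
pose R (M : 'M[bool]_(n, k)) i := row_sums M i ord0.
pose C (M : 'M[bool]_(n, k)) j := col_sums M ord0 j.
(* The column sums count the entries 1, hence the compensating term on the
   left: with it every entry, 0 or 1, contributes [2 g j + 1]. *)
have W_margins M : W M + \sum_j C M j * (g j).*2.+1
    = \sum_i R M i * (f i).*2 + \sum_j n * (g j).*2.+1.
  have -> : W M = \sum_i R M i * (f i).*2 + \sum_i \sum_j ~~ M i j * (g j).*2.+1.
    rewrite -big_split; apply: eq_bigr => i _ /=.
    by rewrite big_split /R mxE big_distrl.
  rewrite -addnA exchange_big -big_split; congr (_ + _); apply: eq_bigr => j _ /=.
  rewrite /C mxE big_distrl -big_split /= -[in RHS](card_ord n) -sum_nat_const.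
  by apply: eq_bigr => i _; case: (M i j); rewrite ?mul0n ?mul1n ?addn0.
have eqW : W B = W A.
  apply/eqP; rewrite -(eqn_add2r (\sum_j C A j * (g j).*2.+1)) W_margins.
  by rewrite -{1}/C /C /R -eq_col W_margins /R eq_row.
have le_w i j : w (B i j) i j <= w (A i j) i j ?= iff (B i j == A i j).
  apply/leqifP; rewrite A_fg /w.
  by case: (B i j); case: ltnP => fg /=;
    rewrite ?mul1n ?mul0n ?addn0 ?add0n ?eqxx // ?ltn_Sdouble ?ltnS ?leq_double.
have : W B <= W A ?= iff [forall i in predT, forall j in predT, B i j == A i j].
  by apply: leqif_sum => i _; apply: leqif_sum => j _.
case=> _; rewrite eqW eqxx => /esym/forall_inP eq_BA.
by apply/eqP/matrixP => i j; have /forall_inP/(_ j isT)/eqP := eq_BA i isT.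
Qed.

Definition col_set n k (A : 'M[bool]_(n, k)) (j : 'I_k) : {set 'I_n} :=
  [set i | A i j].

Definition col_sets n k (A : 'M[bool]_(n, k)) : {set {set 'I_n}} :=
  [set col_set A j | j : 'I_k].

(** One half of Ryser's criterion: a permutation submatrix on rows [i], [i'] and
    columns [j], [j'] can be flipped without changing the margins. *)
Lemma lonesum_col_chain n k (A : 'M[bool]_(n, k)) j j' :
  lonesum A ->
  (col_set A j \subset col_set A j') || (col_set A j' \subset col_set A j).
Proof.
move=> lonA; apply: contraT; rewrite negb_or => /andP[/subsetPn[i] + + /subsetPn[i']].
rewrite !inE => Aij /negPf Aij' Aij'' /negPf Ai'j.
(* [B] is the flipped matrix, described as [A] with columns [j] and [j']
   exchanged inside rows [i] and [i'].  This shows that the row sums are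
   unchanged; [BE] describes it with the two axes exchanged, for the column
   sums. *)
pose B : 'M[bool]_(n, k) := (\matrix_(x, y)
  if (x == i) || (x == i') then A x (tperm j j' y) else A x y)%R.
have BE x y : B x y =
    if (y == j) || (y == j') then A (tperm i i' x) y else A x y.
  rewrite mxE; do 2!case: tpermP => [->|->|/eqP/negPf-> /eqP/negPf->] //;
    by rewrite ?eqxx ?orbT //= ?Aij ?Aij' ?Aij'' ?Ai'j // !if_same.
have /forallP/(_ B)/implyP lonB := lonA.
suff /lonB/eqP/matrixP/(_ i j) :
  (row_sums B == row_sums A) && (col_sums B == col_sums A).
  by rewrite mxE eqxx tpermL Aij Aij'.
apply/andP; split; apply/eqP/matrixP => x y; rewrite !mxE.
  under eq_bigr do rewrite mxE.
  by case: (_ || _) => //; rewrite [RHS](reindex_inj (@perm_inj _ (tperm j j'))).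
under eq_bigr do rewrite BE.
by case: (_ || _) => //; rewrite [RHS](reindex_inj (@perm_inj _ (tperm i i'))).
Qed.

(** * Ladders *)

(** The Ferrers diagram of row heights [f], up to a permutation of the rows and
    with the columns arranged along [g]. *)
Definition ladder n k m (f : {ffun 'I_n -> 'I_m.+1}) (g : {ffun 'I_k -> 'I_m}) :
    'M[bool]_(n, k) := (\matrix_(i, j) (g j < f i))%R.

Lemma row_heightsP n m (f : {ffun 'I_n -> 'I_m.+1}) :
  reflect (forall v : 'I_m, exists i, f i = v.+1 :> nat) (f \in row_heights n m).
Proof.
rewrite inE; apply: (iffP subsetP) => [sub v|hit v].
  have /sub/imsetP[i _ fi] : lift ord0 v \in [set~ ord0] by rewrite !inE.
  by exists i; rewrite -fi.
rewrite !inE => v0; case: (unliftP ord0 v) v0 => [u|] -> // _.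
have [i fi] := hit u; apply/imsetP; exists i => //; exact: val_inj.
Qed.

Lemma ontoTP (aT rT : finType) (f : {ffun aT -> rT}) :
  reflect (forall y, exists x, f x = y) (f \in onto aT [set: rT]).
Proof.
rewrite inE -subTset; apply: (iffP subsetP) => [sub y|hit y _].
  by have /imsetP[x _ ->] := sub y (in_setT y); exists x.
by have [x <-] := hit y; rewrite imset_f.
Qed.

Section Ladder.

Variables (n k m : nat) (f : {ffun 'I_n -> 'I_m.+1}) (g : {ffun 'I_k -> 'I_m}).
Hypotheses (Hf : f \in row_heights n m) (Hg : g \in onto 'I_k [set: 'I_m]).

Let level (v : 'I_m) : {set 'I_n} := [set i | v < f i].

Let level_inj : injective level.
Proof.
have sub u v : level u = level v -> u <= v.
  have [i fi] := row_heightsP _ Hf v; move/setP/(_ i); rewrite !inE fi ltnSn.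
  by rewrite ltnS.
by move=> u v uv; apply/val_inj/anti_leq; rewrite !sub.
Qed.

Lemma col_sets_ladder : col_sets (ladder f g) = level @: setT.
Proof.
have col_level j : col_set (ladder f g) j = level (g j).
  by apply/setP=> i; rewrite !inE mxE.
apply/setP => S; apply/imsetP/imsetP => [[j _ ->]|[v _ ->]].
  by exists (g j).
by have [j <-] := ontoTP _ Hg v; exists j.
Qed.

Lemma card_col_sets_ladder : #|col_sets (ladder f g)| = m.
Proof. by rewrite col_sets_ladder card_imset // cardsT card_ord. Qed.

Lemma ladder_height i : #|[set S in col_sets (ladder f g) | i \in S]| = f i.
Proof.
have -> : [set S in col_sets (ladder f g) | i \in S]
    = level @: [set v : 'I_m | v < f i].
  apply/setP=> S; rewrite inE col_sets_ladder.
  apply/andP/imsetP => [[/imsetP[v _ ->]]|[v]]; rewrite !inE => vf.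
    by exists v; rewrite ?inE.
  by move=> ->; rewrite inE imset_f.
have fm : f i <= m by rewrite -ltnS.
have widen_inj : injective (widen_ord fm) by move=> u v [/val_inj].
rewrite card_imset // -[RHS]card_ord -(card_imset _ widen_inj).
apply: eq_card => v; rewrite inE.
apply/idP/imsetP => [vf|[u _ ->] /=]; last by [].
by exists (Ordinal vf) => //; apply: val_inj.
Qed.

Lemma ladder_col_neq0 : every_col_has_1 (ladder f g).
Proof.
apply/forallP => j; have [i fi] := row_heightsP _ Hf (g j).
by apply/existsP; exists i; rewrite mxE fi.
Qed.

Lemma ladder_row_neq0 :
  every_row_has_1 (ladder f g) = [forall i, f i != ord0].
Proof.
apply/forallP/forallP => rows i.
  by have /existsP[j] := rows i; rewrite mxE; apply: contraTneq => ->.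
have := rows i; case: (unliftP ord0 (f i)) => [v fi _|->]; last by rewrite eqxx.
by have [j gj] := ontoTP _ Hg v; apply/existsP; exists j; rewrite mxE gj fi.
Qed.

End Ladder.

Lemma ladder_lonesum n k m (f : {ffun 'I_n -> 'I_m.+1}) (g : {ffun 'I_k -> 'I_m}) :
  lonesum (ladder f g).
Proof. by apply: threshold_lonesum => i j; rewrite mxE. Qed.

(** The heights are recovered by [ladder_height]; they then separate the levels
    of the columns, since a row of height [v.+1] has a 1 exactly in the columns
    of level at most [v]. *)
Lemma ladder_inj n k m (f f' : {ffun 'I_n -> 'I_m.+1}) (g g' : {ffun 'I_k -> 'I_m}) :
  f \in row_heights n m -> g \in onto 'I_k [set: 'I_m] ->
  f' \in row_heights n m -> g' \in onto 'I_k [set: 'I_m] ->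
  ladder f g = ladder f' g' -> (f, g) = (f', g').
Proof.
move=> Hf Hg Hf' Hg' eqA.
have eqf : f = f'.
  apply/ffunP => i; apply: val_inj.
  by rewrite /= -(ladder_height Hf Hg) -(ladder_height Hf' Hg') eqA.
rewrite -{}eqf in Hf' eqA *; congr (_, _).
have le_g g1 g2 j : ladder f g1 = ladder f g2 -> g1 j <= g2 j.
  move/matrixP; have [i fi] := row_heightsP _ Hf (g2 j).
  by move/(_ i j); rewrite !mxE fi ltnSn.
by apply/ffunP => j; apply/val_inj/anti_leq; rewrite !le_g.
Qed.

(** In the chain of distinct columns, those containing row [i] are the largest
    ones, so column [j] is among them exactly when fewer columns strictly
    contain it than contain [i]. *)
Lemma ladder_surj n k (A : 'M[bool]_(n, k)) :
  lonesum A -> every_col_has_1 A ->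
  exists m (f : {ffun 'I_n -> 'I_m.+1}) (g : {ffun 'I_k -> 'I_m}),
    [/\ f \in row_heights n m, g \in onto 'I_k [set: 'I_m] & A = ladder f g].
Proof.
move=> lonA /forallP colA; pose m := #|col_sets A|.
have col_in j : col_set A j \in col_sets A by rewrite imset_f.
pose above (S : {set 'I_n}) := [set T in col_sets A | S \proper T].
have above_lt S : S \in col_sets A -> #|above S| < m.
  move=> S_A; apply: proper_card; apply/properP; split.
    by apply/subsetP => T; rewrite inE => /andP[].
  by exists S => //; rewrite inE properxx andbF.
pose containing i := [set T in col_sets A | i \in T].
have containing_le i : #|containing i| < m.+1.
  by rewrite ltnS; apply/subset_leq_card/subsetP => T; rewrite inE => /andP[].
pose f := [ffun i => Ordinal (containing_le i)].
pose g := [ffun j => Ordinal (above_lt _ (col_in j))].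
have A_ladder : A = ladder f g.
  apply/matrixP => i j; rewrite mxE !ffunE /=.
  case Aij: (A i j).
    symmetry; apply: proper_card; apply/properP; split.
      apply/subsetP => T; rewrite !inE => /andP[-> /proper_sub/subsetP]; apply.
      by rewrite inE.
    by exists (col_set A j); rewrite inE ?properxx ?andbF // col_in inE.
  symmetry; apply/negbTE; rewrite -leqNgt; apply/subset_leq_card/subsetP => T.
  rewrite !inE => /andP[TA]; rewrite TA /=.
  case/imsetP: TA => j' _ ->; rewrite inE => Aij'.
  rewrite properE andbC; have ns : ~~ (col_set A j' \subset col_set A j).
    by apply/subsetPn; exists i; rewrite inE ?Aij.
  by rewrite ns /=; have := lonesum_col_chain j j' lonA; rewrite (negPf ns) orbF.
have above_sub S T : S \in col_sets A -> T \in col_sets A ->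
    #|above S| <= #|above T| -> T \subset S.
  move=> SA TA; apply: contraTT => nTS.
  have ST : S \proper T.
    rewrite properE nTS andbT; case/imsetP: SA nTS => j _ ->.
    case/imsetP: TA => j' _ -> /negPf nTS.
    by have := lonesum_col_chain j j' lonA; rewrite nTS orbF.
  rewrite -ltnNge; apply: proper_card; apply/properP; split.
    by apply/subsetP => U; rewrite !inE => /andP[-> /(proper_trans ST)].
  by exists T; rewrite inE ?properxx ?andbF // TA.
have g_onto : g \in onto 'I_k [set: 'I_m].
  rewrite inE eqEcard subsetT cardsT card_ord /=.
  (* [h] is [g] seen on the distinct columns: injective into a set of size
     [m], hence onto.  Its values are optional only because it must be defined
     on sets that are not columns too. *)
  pose h (S : {set 'I_n}) : option 'I_m := insub #|above S|.
  have h_col j : h (col_set A j) = Some (g j).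
    rewrite /h insubT ?above_lt // => lt; rewrite ffunE.
    by congr Some; apply: val_inj.
  have h_inj : {in col_sets A &, injective h}.
    move=> S T SA TA; rewrite /h !insubT ?above_lt // => lt_S lt_T [eq_above].
    by apply/eqP; rewrite eqEsubset !above_sub ?eq_above.
  rewrite -(card_imset _ (@Some_inj _)).
  apply: (@leq_trans #|h @: col_sets A|); first by rewrite (card_in_imset h_inj).
  apply/subset_leq_card/subsetP => _ /imsetP[_ /imsetP[j _ ->] ->].
  by rewrite h_col !imset_f.
exists m, f, g; split=> //; apply/row_heightsP => v.
have [j gj] := ontoTP _ g_onto v.
(* A row in the column of level [v] but not in the next one has height [v.+1];
   at the last level any row of the column will do. *)
have [i /andP[fi_gt fi_le]] : exists i, v < f i <= v.+1.
  case: (ltnP v.+1 m) => [vm|mv].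
    have [j' gj'] := ontoTP _ g_onto (Ordinal vm).
    have /subsetPn[i] : ~~ (col_set A j \subset col_set A j').
      apply/negP => sub; suff : g j' <= g j by rewrite gj gj' ltnn.
      rewrite !ffunE /=; apply/subset_leq_card/subsetP => U; rewrite !inE.
      by case/andP=> -> /(sub_proper_trans sub).
    rewrite !inE A_ladder !mxE gj gj' -leqNgt => ? ?; exists i; exact/andP.
  have /existsP[i] := colA j; rewrite {1}A_ladder mxE gj => fi; exists i.
  by rewrite fi (leq_trans _ mv) // -ltnS.
by exists i; apply/anti_leq; rewrite fi_gt fi_le.
Qed.

(** * Counting *)

Lemma row_heights_le n m (f : {ffun 'I_n -> 'I_m.+1}) :
  f \in row_heights n m -> m <= n.
Proof.
rewrite inE => /subset_leq_card; rewrite cardsC1 card_ord => /leq_trans; apply.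
by rewrite -[n in _ <= n]card_ord -cardsT leq_imset_card.
Qed.

(** The property [p] leaves room for a further condition on the matrix that
    depends on the heights [f] alone, such as the absence of zero rows. *)
Lemma card_ladders n k (p : pred 'M[bool]_(n, k))
    (q : forall m, pred {ffun 'I_n -> 'I_m.+1}) :
  (forall m (f : {ffun 'I_n -> 'I_m.+1}) (g : {ffun 'I_k -> 'I_m}),
     f \in row_heights n m -> g \in onto 'I_k [set: 'I_m] ->
     p (ladder f g) = q m f) ->
  #|[set A | [&& lonesum A, every_col_has_1 A & p A]]|
    = \sum_(0 <= m < (minn n k).+1)
        #|[set f in row_heights n m | q m f]| * (m`! * stirling2 k m).
Proof.
move=> pq; rewrite big_mkord -sum1_card.
(* [inord] is faithful here: a ladder with [m] levels needs [m] distinct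
   positive heights and [m] distinct columns, so [m <= minn n k]. *)
pose rk (A : 'M[bool]_(n, k)) : 'I_(minn n k).+1 := inord #|col_sets A|.
rewrite (partition_big rk predT) //; apply: eq_bigr => m _.
have -> : m`! * stirling2 k m = #|onto 'I_k [set: 'I_m]|.
  by rewrite card_onto cardsT card_ord.
rewrite -cardsX.
pose lad (fg : {ffun 'I_n -> 'I_m.+1} * {ffun 'I_k -> 'I_m}) := ladder fg.1 fg.2.
rewrite -(@card_in_imset _ _ lad) => [|[f g] [f' g']]; last first.
  move=> /setXP[/= /setIdP[Hf _] Hg] /setXP[/= /setIdP[Hf' _] Hg'].
  exact: ladder_inj.
rewrite -sum1_card; apply: eq_bigl => A; rewrite inE.
apply/idP/imsetP => [/andP[/and3P[lonA colA pA] /eqP rkA]|[[f g]]].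
  have [m' [f [g [Hf Hg defA]]]] := ladder_surj lonA colA.
  have m'm : m' = m.
    rewrite -rkA /rk defA card_col_sets_ladder // inordK //.
    rewrite ltnS leq_min (row_heights_le Hf) -(card_col_sets_ladder Hf Hg).
    by rewrite (leq_trans (leq_imset_card _ _)) // card_ord.
  move: f g Hf Hg defA; rewrite m'm => f g Hf Hg defA.
  exists (f, g) => //; apply/setXP; split=> //; apply/setIdP; split=> //=.
  by rewrite -(pq _ _ _ Hf Hg) -defA.
case/setXP=> /= /setIdP[Hf qf] Hg ->; rewrite /lad /=.
rewrite ladder_lonesum ladder_col_neq0 // pq //= qf /rk card_col_sets_ladder //.
by rewrite inord_val eqxx.
Qed.

Theorem theorem2 :
  (forall n k : nat, 1 <= n ->
     num_lonesum_C n k =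
     \sum_(0 <= m < (minn n k).+1)
        m`! ^ 2 * stirling2 n.+1 m.+1 * stirling2 k m)
  /\
  (forall n k : nat, 1 <= n -> 1 <= k ->
     num_lonesum_D n k =
     \sum_(0 <= m < (minn n k).+1)
        m`! ^ 2 * stirling2 n m * stirling2 k m).
Proof.
have assemble m a b : m`! * a * (m`! * b) = m`! ^ 2 * a * b by rewrite mulnACA mulnA.
split=> n k _ => [|_].
  transitivity
    #|[set A : 'M[bool]_(n, k) | [&& lonesum A, every_col_has_1 A & true]]|.
    by apply: eq_card => A; rewrite !inE andbT.
  rewrite (@card_ladders _ _ predT (fun=> predT)) //; apply: eq_bigr => m _.
  rewrite -assemble -card_row_heights; congr (_ * _).
  by apply: eq_card => f; rewrite !inE andbT.
rewrite /num_lonesum_D (@card_ladders _ _ _ (fun m f => [forall i, f i != ord0])).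
  apply: eq_bigr => m _; rewrite -assemble; congr (_ * _).
  have cardC : #|[set~ (ord0 : 'I_m.+1)]| = m by rewrite cardsC1 card_ord.
  rewrite -[in RHS]cardC -card_onto; apply: eq_card => f; rewrite !inE.
  rewrite eqEsubset andbC; congr (_ && _); apply/forallP/subsetP => f0.
    by move=> _ /imsetP[i _ ->]; rewrite !inE.
  by move=> i; have := f0 _ (imset_f f (in_setT i)); rewrite !inE.
by move=> m f g Hf Hg; apply: ladder_row_neq0.
Qed.
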